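(* Let $R$ be a finite commutative Frobenius ring with unity, $|R|=\ell$, let $b,n\ge1$ and $1\le t\le b$ be integers, and let $C,D\subseteq R^{bn}$ be byte error-control codes (linear codes) with byte length $b$. For $n$-tuples $j,k,\delta\in\{0,\ldots,b\}^n$ let $A_\delta(j;k)$ be the number of pairs $(\mathbf u,\mathbf v)$ with $\mathbf u\in C$, $\mathbf v\in D$, $w_D(\mathbf u)=j$, $w_D(\mathbf v)=k$ and $w_D(\mathbf u\cap\mathbf v)=\delta$. Then (i) $\displaystyle \mathcal J_{C^\perp,D}(x,y,z)=\frac1{|C|}\sum_{j,k}\sum_{\delta=0}^{j\vee k}A_\delta(j;k)\,G^{(\delta)}_{j,k}(x,y,z)$; (ii) $\displaystyle \mathcal J_{C,D^\perp}(x,y,z)=\frac1{|D|}\sum_{j,k}\sum_{\delta=0}^{j\vee k}A_\delta(j;k)\,G^{(\delta)}_{k,j}(y,x,z)$; (iii) $\displaystyle \mathcal J_{C^\perp,D^\perp}(x,y,z)=\frac1{|C||D|}\sum_{j,k}\sum_{\delta=0}^{j\vee k}A_\delta(j;k)\,H^{(\delta)}_{j,k}(y,x,z)$. Here $\sum_{j,k}$ runs over all $n$-tuples $j=(j_1,\ldots,j_n)$, $k=(k_1,\ldots,k_n)$ with $0\le j_i,k_i\le b$; the sum over $\delta$ runs over $n$-tuples $\delta=(\delta_1,\ldots,\delta_n)$ with $0\le\delta_i\le \min\{j_i,k_i\}$ for each $i$; and $\mathcal J$, $G$, $H$ are the joint $m$-spotty Hamming weight enumerator and the polynomials defined in the 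context.
   Context: **Codes.** A finite commutative ring $R$ is Frobenius if it is self-injective. A byte error-control code of length $bn$ and byte length $b$ is an $R$-submodule of $R^{bn}$; vectors are written $\mathbf u=(\mathbf u_1,\ldots,\mathbf u_n)$ with bytes $\mathbf u_i=(u_{i1},\ldots,u_{ib})\in R^b$. $C^\perp$ is the dual with respect to the Euclidean inner product $\sum_{i,j}u_{ij}v_{ij}$. $w_H$ is the Hamming weight (number of nonzero coordinates). The Hamming weight distribution vector of $\mathbf u$ is $w_D(\mathbf u)=(w_H(\mathbf u_1),\ldots,w_H(\mathbf u_n))$. $\mathbf u\cap\mathbf v\in\{0,1\}^{bn}$ has $(i,j)$ entry $1$ if $u_{ij}\ne0$ and $v_{ij}\neq 0$, and $0$ otherwise. $j\vee k$ is the componentwise minimum. **Joint enumerator.** For an integer $a\ge 0$ let $\overline a$ be the least nonnegative residue of $a$ modulo $t$. For nonnegative integers $a,c$ define $\varepsilon(a,c)=0$ if $\overline a+\overline c=0$; $1$ if $0<\overline a+\overline c\le t$; $2$ if $t<\overline a+\overline c\le 2t-2$. For $\mathbf u',\mathbf v'\in R^b$ let $f_{01}$, $f_{10}$, $f_{11}$ be the numbers of positions $j$ with, respectively, $(u'_j=0,v'_j\ne0)$, $(u'_j\ne0,v'_j=0)$, $(u'_j\neq0,v'_j\ne0)$. Put $J(\mathbf u',\mathbf v')=\lfloor f_{01}/t\rfloor+\varepsilon(f_{01},f_{11})$, $K(\mathbf u',\mathbf v')=\lfloor f_{10}/t\rfloor+\varepsilon(f_{10},f_{11})$, $L(\mathbf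 u',\mathbf v')=\lfloor f_{11}/t\rfloor$. For $\mathbf u,\mathbf v\in R^{bn}$ put $J(\mathbf u,\mathbf v)=\sum_{i=1}^n J(\mathbf u_i,\mathbf v_i)$, and similarly for $K,L$. The joint $m$-spotty Hamming weight enumerator of codes $C,D$ is $$\mathcal J_{C,D}(x,y,z)=\sum_{\mathbf u\in C}\sum_{\mathbf v\in D}x^{J(\mathbf u,\mathbf v)}y^{K(\mathbf u,\mathbf v)}z^{L(\mathbf u,\mathbf v)}.$$ **Polynomials $G$.** For integers $0\le\nu,\mu\le b$ and $\nu+\mu-b\le\delta\le\min\{\nu,\mu\}$ with $\delta\ge0$, and $0\le p\le b$, let $\mathcal A_p$ be the set of $4$-tuples $\alpha=(\alpha_1,\alpha_2,\alpha_3,\alpha_4)$ of nonnegative integers with sum $p$, $\alpha_1\le\delta$, $\alpha_2\le\mu-\delta$, $\alpha_3\le\nu-\delta$, $\alpha_4\le b+\delta-\nu-\mu$. Then $$G^{(\delta)}_{\nu,\mu}(x,y,z)=\sum_{p=0}^b\sum_{\alpha\in\mathcal A_p}g_p(\alpha)\,x^{\lfloor\frac{\mu-\alpha_1-\alpha_2}{t}\rfloor+\theta}\,y^{\lfloor\frac{p-\alpha_1-\alpha_2}{t}\rfloor+\eta}\,z^{\lfloor\frac{\alpha_1+\alpha_2}{t}\rfloor},$$ with $g_p(\alpha)=\binom{\delta}{\alpha_1}\binom{\mu-\delta}{\alpha_2}\binom{\nu-\delta}{\alpha_3}\binom{b+\delta-\mu-\nu}{\alpha_4}(-1)^{\alpha_1+\alpha_3}(\ell-1)^{p-\alpha_1-\alpha_3}$,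 $\theta=\varepsilon(\mu-\alpha_1-\alpha_2,\alpha_1+\alpha_2)$, $\eta=\varepsilon(p-\alpha_1-\alpha_2,\alpha_1+\alpha_2)$. (Set $G^{(\delta)}_{\nu,\mu}=0$ if $\delta<\nu+\mu-b$.) **Polynomials $H$.** For a pattern $\ell_1\ell_2\ell_3\ell_4$ over $\{0,1,*\}$, $T_{\ell_1\ell_2\ell_3\ell_4}$ is the set of $a\in\{0,1\}^4$ whose $i$-th entry equals $\ell_i$ whenever $\ell_i\in\{0,1\}$ (no condition when $\ell_i=*$). For integers $0\le \mu,\nu,\delta,p,q\le b$ let $\mathcal B_{pq}$ be the set of tuples $\alpha=(\alpha_a)_{a\in\{0,1\}^4}$ of nonnegative integers with $\sum_{T_{1**1}}\alpha_a=\delta$, $\sum_{T_{1***}}\alpha_a=\nu$, $\sum_{T_{***1}}\alpha_a=\mu$, $\sum_{a}\alpha_a=b$, $\sum_{T_{*1**}}\alpha_a=p$, $\sum_{T_{**1*}}\alpha_a=q$. Then (note the order of the subscripts) $$H^{(\delta)}_{\mu,\nu}(x,y,z)=\sum_{p,q=0}^b\sum_{\alpha\in\mathcal B_{pq}}h_{pq}(\alpha)\,x^{\lfloor\frac{q-\psi}{t}\rfloor+\zeta}\,y^{\lfloor\frac{p-\psi}{t}\rfloor+\omega}\,z^{\lfloor\frac{\psi}{t}\rfloor},$$ where $\phi=\sum_{T_{11**}}\alpha_a+\sum_{T_{**11}}\alpha_a$, $\psi=\sum_{T_{*11*}}\alpha_a$, $\zeta=\varepsilon(q-\psi,\psi)$,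 $\omega=\varepsilon(p-\psi,\psi)$ and $$h_{pq}(\alpha)=\frac{\delta!\,(\nu-\delta)!\,(\mu-\delta)!\,(b+\delta-\nu-\mu)!}{\prod_{a}\alpha_a!}(-1)^{\phi}(\ell-1)^{p+q-\phi}.$$ (If $\mathcal B_{pq}$ is empty for all $p,q$ then $H^{(\delta)}_{\mu,\nu}=0$.) For $n$-tuples $j,k,\delta$: $G^{(\delta)}_{j,k}=\prod_{i=1}^n G^{(\delta_i)}_{j_i,k_i}$ and $H^{(\delta)}_{j,k}=\prod_{i=1}^n H^{(\delta_i)}_{j_i,k_i}$ (so the first subscript of $G$ plays the role of $\nu$ and the first subscript of $H$ plays the role of $\mu$). *)

(* Defs.v *)
From mathcomp Require Import all_boot all_order all_algebra.
From mathcomp Require Import mpoly.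

Set Implicit Arguments.
Unset Strict Implicit.
Unset Printing Implicit Defensive.

Import GRing.Theory.
Local Open Scope ring_scope.

Definition injective_module (R : pzRingType) (E : lmodType R) : Prop :=
  forall (M N : lmodType R) (f : {linear M -> N}) (g : {linear M -> E}),
    injective f -> exists h : {linear N -> E}, forall m, h (f m) = g m.

(* For a finite commutative ring, Frobenius means self-injective. *)
Definition frobenius (R : finComPzRingType) : Prop := injective_module R^o.

(* A vector of R^(bn) made of n bytes of length b is an n x b matrix over R
   whose i-th row is the i-th byte. *)
Definition byte_code (R : finComPzRingType) (n b : nat)
  (C : {set 'M[R]_(n, b)}) : Prop := GRing.submod_closed C.

Definition dual (R : finComPzRingType) (n b : nat) (C : {set 'M[R]_(n, b)}) :
  {set 'M[R]_(n, b)} :=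
  [set v : 'M[R]_(n, b) |
    [forall u in C, \sum_(i < n) \sum_(j < b) u i j * v i j == 0]].

Definition wH (V : nmodType) (b : nat) (u : 'rV[V]_b) : nat :=
  #|[set j : 'I_b | u 0 j != 0]|.

Definition wD (V : nmodType) (n b : nat) (u : 'M[V]_(n, b)) : 'I_n -> nat :=
  fun i => wH (row i u).

Definition cap_vec (R : finComPzRingType) (n b : nat) (u v : 'M[R]_(n, b)) :
  'M[nat]_(n, b) :=
  \matrix_(i < n, j < b) (if (u i j != 0) && (v i j != 0) then 1%N else 0%N).

Notation wtuple n b := {ffun 'I_n -> 'I_b.+1}.

Definition Acount (R : finComPzRingType) (n b : nat)
  (C D : {set 'M[R]_(n, b)}) (d j k : wtuple n b) : nat :=
  #|[set uv : 'M[R]_(n, b) * 'M[R]_(n, b) |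
      [&& uv.1 \in C, uv.2 \in D,
          [forall i, wD uv.1 i == j i], [forall i, wD uv.2 i == k i]
        & [forall i, wD (cap_vec uv.1 uv.2) i == d i]]]|.

(* The third case stands for t < a mod t + c mod t <= 2t - 2, which is all that
   is left when 0 < t. *)
Definition eps (t a c : nat) : nat :=
  let s := (a %% t + c %% t)%N in
  if s == 0%N then 0%N else if (s <= t)%N then 1%N else 2%N.

Section JointEnumerator.
Variables (R : finComPzRingType) (t n b : nat).
Implicit Types (u v : 'rV[R]_b).

Definition f01 u v : nat := #|[set j : 'I_b | (u 0 j == 0) && (v 0 j != 0)]|.
Definition f10 u v : nat := #|[set j : 'I_b | (u 0 j != 0) && (v 0 j == 0)]|.
Definition f11 u v : nat := #|[set j : 'I_b | (u 0 j != 0) && (v 0 j != 0)]|.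

Definition Jbyte u v : nat := (f01 u v %/ t + eps t (f01 u v) (f11 u v))%N.
Definition Kbyte u v : nat := (f10 u v %/ t + eps t (f10 u v) (f11 u v))%N.
Definition Lbyte u v : nat := (f11 u v %/ t)%N.

Implicit Types (x y : 'M[R]_(n, b)).

Definition Jvec x y : nat := (\sum_(i < n) Jbyte (row i x) (row i y))%N.
Definition Kvec x y : nat := (\sum_(i < n) Kbyte (row i x) (row i y))%N.
Definition Lvec x y : nat := (\sum_(i < n) Lbyte (row i x) (row i y))%N.

End JointEnumerator.

Notation poly3 := {mpoly rat[3]}.

Definition varx : poly3 := 'X_(@Ordinal 3 0 isT).
Definition vary : poly3 := 'X_(@Ordinal 3 1 isT).
Definition varz : poly3 := 'X_(@Ordinal 3 2 isT).

(* P(x, y, z) |-> P(y, x, z) *)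
Definition swapxy (P : poly3) : poly3 := comp_mpoly [tuple vary; varx; varz] P.

Definition joint_enum (R : finComPzRingType) (t n b : nat)
  (C D : {set 'M[R]_(n, b)}) : poly3 :=
  \sum_(u in C) \sum_(v in D)
    varx ^+ Jvec t u v * vary ^+ Kvec t u v * varz ^+ Lvec t u v.

(* In the definitions of G and H below, each truncated subtraction is an exact
   one wherever it contributes to a value for delta <= minn nu mu. *)

Section PolynomialG.
Variables (t b ell : nat).

(* The tuple (alpha_1, ..., alpha_4) is indexed from 0. Its entries sum to
   p <= b, so nothing is lost by bounding each of them by b. *)
Definition Aset (nu mu delta p : nat) : {set 4.-tuple 'I_b.+1} :=
  [set a : 4.-tuple 'I_b.+1 |
    [&& (\sum_(i < 4) (tnth a i : nat) == p)%N,
        (tnth a (inord 0) <= delta)%N,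
        (tnth a (inord 1) <= mu - delta)%N,
        (tnth a (inord 2) <= nu - delta)%N
      & (tnth a (inord 3) <= b + delta - nu - mu)%N]].

Definition gcoef (nu mu delta p : nat) (a1 a2 a3 a4 : nat) : rat :=
  ('C(delta, a1) * 'C(mu - delta, a2) * 'C(nu - delta, a3)
     * 'C(b + delta - mu - nu, a4))%:R
  * (-1) ^+ (a1 + a3) * (ell%:R - 1) ^+ (p - a1 - a3).

Definition Gbyte (nu mu delta : nat) : poly3 :=
  if (nu + mu <= b + delta)%N then
    \sum_(p < b.+1) \sum_(a in Aset nu mu delta p)
      let a1 : nat := tnth a (inord 0) in
      let a2 : nat := tnth a (inord 1) in
      let a3 : nat := tnth a (inord 2) in
      let a4 : nat := tnth a (inord 3) in
      let theta := eps t (mu - a1 - a2) (a1 + a2) in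
      let eta := eps t (p - a1 - a2) (a1 + a2) in
      gcoef nu mu delta p a1 a2 a3 a4 *:
        (varx ^+ ((mu - a1 - a2) %/ t + theta)
         * vary ^+ ((p - a1 - a2) %/ t + eta)
         * varz ^+ ((a1 + a2) %/ t))
  else 0.

Definition Gpoly (n : nat) (d j k : wtuple n b) : poly3 :=
  \prod_(i < n) Gbyte (j i) (k i) (d i).

End PolynomialG.

(* [None] plays the role of the wildcard [*] of a pattern. *)
Definition Tset (l : 4.-tuple (option bool)) : {set 4.-tuple bool} :=
  [set a : 4.-tuple bool |
    [forall i, if tnth l i is Some c then tnth a i == c else true]].

Section PolynomialH.
Variables (t b ell : nat).

Notation I := (Some true).
Notation N := (@None bool).
Notation index := {ffun 4.-tuple bool -> 'I_b.+1}.

Definition Tsum (al : index) (l : 4.-tuple (option bool)) : nat :=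
  (\sum_(a in Tset l) (al a : nat))%N.

(* As the entries sum to b, nothing is lost by bounding each of them by b. *)
Definition Bset (mu nu delta p q : nat) : {set index} :=
  [set al : index |
    [&& Tsum al [tuple I; N; N; I] == delta,
        Tsum al [tuple I; N; N; N] == nu,
        Tsum al [tuple N; N; N; I] == mu,
        (\sum_a (al a : nat) == b)%N,
        Tsum al [tuple N; I; N; N] == p
      & Tsum al [tuple N; N; I; N] == q]].

Definition phi (al : index) : nat :=
  (Tsum al [tuple I; I; N; N] + Tsum al [tuple N; N; I; I])%N.

Definition psi (al : index) : nat := Tsum al [tuple N; I; I; N].

Definition hcoef (mu nu delta p q : nat) (al : index) : rat :=
  (delta`! * (nu - delta)`! * (mu - delta)`! * (b + delta - nu - mu)`!)%:R
  / (\prod_a (al a)`!)%:R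
  * (-1) ^+ phi al * (ell%:R - 1) ^+ (p + q - phi al).

Definition Hbyte (mu nu delta : nat) : poly3 :=
  \sum_(p < b.+1) \sum_(q < b.+1) \sum_(al in Bset mu nu delta p q)
    let zeta := eps t (q - psi al) (psi al) in
    let omega := eps t (p - psi al) (psi al) in
    hcoef mu nu delta p q al *:
      (varx ^+ ((q - psi al) %/ t + zeta)
       * vary ^+ ((p - psi al) %/ t + omega)
       * varz ^+ (psi al %/ t)).

(* The first lower index of H is mu, whereas that of G is nu. *)
Definition Hpoly (n : nat) (d j k : wtuple n b) : poly3 :=
  \prod_(i < n) Hbyte (j i) (k i) (d i).

End PolynomialH.

(* Main.v *)
(** The only consequence of self-injectivity that is needed is |C| |C^perp| = |R|^N for
    every submodule C of R^N.  Along a chain of submodules with simple quotients R/m the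
    product |C| |C^perp| can only increase, since injectivity makes Ann(m) a quotient of
    R/m; it equals |R|^N at both ends of a maximal chain, hence everywhere.  Applied to
    C + R^(W^c) this counts the words of C^perp supported in a set W of coordinates, and
    Moebius inversion over W gives the MacWilliams identity for the distribution of
    supports, with no need for a generating character.  All three enumerators are sums
    over supports of a product over bytes, so the transform factors byte by byte; grouping
    the supports inside one byte by the sizes of their intersections with the given
    supports produces binomial coefficients (G) and multinomial coefficients (H). *)
Require Import Defs.
From mathcomp Require Import all_boot all_order all_algebra.
From mathcomp Require Import mpoly.
From mathcomp Require Import zify.
From HB Require Import structures.
Import GRing.Theory.
Local Open Scope ring_scope.

Set Implicit Arguments.
Unset Strict Implicit.
Unset Printing Implicit Defensive.

(** * Submodules over a self-injective ring *)

Section Submodule.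
Variables (R : pzRingType) (V : lmodType R) (S : {pred V}).
Hypothesis hS : GRing.submod_closed S.

(** The submodule structure is attached to this alias, so that [submodule] becomes an [lmodType] in
    its own right, the kind of object that [injective_module] quantifies over. *)
Let S' : {pred V} := S.
HB.instance Definition _ := GRing.isSubmodClosed.Build R V S' hS.

Record submodule := Submodule { subval : V; _ : subval \in S' }.
HB.instance Definition _ := [isSub for subval].
HB.instance Definition _ := [Choice of submodule by <:].
HB.instance Definition _ := [SubChoice_isSubLmodule of submodule by <:].

(** Injectivity is applied to the inclusion of [S] in [V]. Asking for linearity on [S] only allows a
    [g] that is defined by choosing preimages. *)
Lemma injective_extend (E : lmodType R) (g : V -> E) :
    injective_module E ->
    (forall a, {in S &, forall u v, g (a *: u + v) = a *: g u + g v}) ->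
  exists h : {linear V -> E}, {in S, h =1 g}.
Proof.
move=> injE gL; pose g' (u : submodule) := g (val u).
have g'L : linear g' by move=> a u v; rewrite /g' linearP gL //; apply: valP.
pose gl : {linear submodule -> E} :=
  HB.pack g' (GRing.isLinear.Build _ _ _ _ g' g'L).
have [h hE] := injE _ _ (val : {linear submodule -> V}) gl val_inj.
by exists h => x xS; have := hE (Submodule xS).
Qed.

End Submodule.

HB.instance Definition _ (U W : finZmodType) := Finite.on (U * W)%type.

(** Each nonempty fiber is a translate of the kernel. Allowing a subset [A] as domain lets one count
    serve codes, products of codes and the whole ring. *)
Lemma card_additive_fibers (U W : finZmodType) (A : {set U}) (f : U -> W) :
    GRing.zmod_closed A -> {in A &, {morph f : u v / u - v}} ->
  #|A| = (#|f @: A| * #|[set u in A | f u == 0%R]|)%N.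
Proof.
move=> [A0 AB] fB.
have AD : {in A &, forall u v, u + v \in A}.
  move=> u v uA vA; rewrite -[v]opprK AB // -[- v]sub0r AB //.
have fD : {in A &, {morph f : u v / u + v}}.
  move=> u v uA vA; have := fB _ _ (AD _ _ uA vA) vA.
  by rewrite addrK => ->; rewrite subrK.
rewrite -sum1_card (partition_big f (mem (f @: A))) /=; last first.
  by move=> u uA; apply: imset_f.
rewrite -sum_nat_const; apply: eq_bigr => w /imsetP[u0 u0A ->].
rewrite sum1dep_card -[RHS](card_imset _ (addrI u0)); apply: eq_card => u.
rewrite !inE; apply/andP/imsetP => [[uA /eqP fu]|[k]].
  exists (u - u0); last by rewrite addrC subrK.
  by rewrite inE AB //= fB // fu subrr.
by rewrite inE => /andP[kA /eqP fk] ->; rewrite AD // fD // fk addr0.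
Qed.

(** * Annihilators of maximal ideals *)

Section Annihilator.
Variable R : finComPzRingType.
Hypothesis hR : frobenius R.

(* A nonzero [a] in Ann(m) has Ann(a) = m by maximality, and self-injectivity then makes
   Ann(m) equal to [aR], which is isomorphic to R/m. *)
Lemma card_annihilator_maximal (m : {set R}) :
    (forall r, r \notin m -> exists s, 1 - s * r \in m) ->
  (#|[set c : R | [forall r in m, (r * c == 0)%R]]| * #|m| <= #|R|)%N.
Proof.
move=> mmax; set ann := [set c | _].
have annP c : reflect (forall r, r \in m -> r * c = 0) (c \in ann).
  rewrite inE; apply: (iffP forallP) => [h r rm|h r].
    by move/implyP: (h r) => /(_ rm)/eqP.
  by apply/implyP => rm; rewrite h.
have [a /andP[aann an0]|noa] := pickP [pred a in ann | a != 0]; last first.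
  have -> : ann = [set 0].
    apply/setP => c; rewrite in_set1; apply/idP/eqP => [cann|->].
      by have := noa c; rewrite /= cann /= => /negbFE/eqP.
    by apply/annP => r _; rewrite mulr0.
  by rewrite cards1 mul1n max_card.
(* If [r a = 0] with [r] outside [m], then some [1 - s r] in [m] kills [a], which forces [a = 0]. *)
have ma r : (r \in m) = (r * a == 0).
  apply/idP/eqP => [|ra0]; first by move/annP: aann; apply.
  apply: contraNT an0 => /mmax[s /(annP _ aann)].
  by rewrite mulrBl mul1r -mulrA ra0 mulr0 subr0 => ->.
pose f := fun r : R => r * a.
(* Since [|R| = |aR| |Ann(a)|], it suffices that [Ann(m)] lies in [aR] and [m] in [Ann(a)]. *)
have := @card_additive_fibers R R setT f.
rewrite cardsT => ->; last 2 first.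
- by split => [|u v _ _]; rewrite inE.
- by move=> u v _ _; rewrite /f mulrBl.
rewrite leq_mul //; last first.
  by apply/subset_leq_card/subsetP => r; rewrite !inE ma.
apply/subset_leq_card/subsetP => c cann.
pose S : {pred R^o} := [pred y | y \in f @: setT].
have SP y : reflect (exists r, y = r * a) (y \in S).
  by rewrite inE; apply: (iffP imsetP) => [[r _ ->]|[r ->]]; exists r.
have hS : GRing.submod_closed S.
  split=> [|s u v /SP[r ->] /SP[r' ->]]; apply/SP.
    by exists 0; rewrite mul0r.
  by exists (s * r + r'); rewrite mulrDl -mulrA.
(* On [aR] this is [r a |-> r c], well defined because [Ann(a) = m] kills [c]; the default 0 is
   taken only outside [aR]. *)
pose g (y : R^o) : R^o := odflt 0 [pick r | y == r * a] * c.
have gE r : g (r * a) = r * c.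
  rewrite /g; case: pickP => [r' /eqP rr'|/(_ r)]; last by rewrite eqxx.
  apply/eqP; rewrite -subr_eq0 -mulrBl (annP _ cann) // ma mulrBl.
  by rewrite /= rr' subrr.
have [|h hE] := injective_extend hS (g := g) hR.
  move=> s u v /SP[r ->] /SP[r' ->].
  have -> : s *: (r * a : R^o) + r' * a = (s * r + r') * a.
    by rewrite mulrDl -mulrA.
  by rewrite !gE mulrDl -mulrA.
have aS : (a : R^o) \in S by apply/SP; exists 1; rewrite mul1r.
(* The extension [h] is multiplication by [h 1], so [c = h a] is a multiple of [a]. *)
have hac : h a = c by rewrite hE // -[a in g a]mul1r gE mul1r.
apply/imsetP; exists (h 1) => //; rewrite /f -hac mulrC -[in LHS](mulr1 a).
exact: (linearZ_LR h a 1).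
Qed.

(** * The size of the dual code *)

Section Dual.
Variables (n b : nat).
Notation V := 'M[R]_(n, b).
Implicit Types (C D : {set V}) (u v x y : V).

Definition dot u v : R := \sum_(i < n) \sum_(j < b) u i j * v i j.

Lemma dotC u v : dot u v = dot v u.
Proof. by apply: eq_bigr => i _; apply: eq_bigr => j _; apply: mulrC. Qed.

Lemma dotP a u v w : dot (a *: u + v) w = a * dot u w + dot v w.
Proof.
rewrite /dot mulr_sumr -big_split; apply: eq_bigr => i _ /=.
rewrite mulr_sumr -big_split; apply: eq_bigr => j _ /=.
by rewrite !mxE mulrDl mulrA.
Qed.

Lemma dot0 w : dot 0 w = 0.
Proof. by rewrite /dot big1 // => i _; rewrite big1 // => j _; rewrite mxE mul0r. Qed.

Lemma dotB u v w : dot (u - v) w = dot u w - dot v w.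
Proof. by rewrite addrC -scaleN1r dotP mulN1r addrC. Qed.

Lemma dot_delta v i j : dot v (delta_mx i j) = v i j.
Proof.
rewrite /dot (bigD1 i) //= (bigD1 j) //= big1 => [|k kj].
  rewrite big1 => [|k ki]; last first.
    by rewrite big1 // => l _; rewrite mxE (negbTE ki) mulr0.
  by rewrite mxE !eqxx mulr1 !addr0.
by rewrite mxE (negbTE kj) andbF mulr0.
Qed.

Lemma dualP C v : reflect {in C, forall u, dot u v = 0} (v \in dual C).
Proof.
rewrite inE; apply: (iffP forallP) => [h u uC|h u].
  by have /implyP/(_ uC)/eqP := h u.
by apply/implyP => uC; apply/eqP/h.
Qed.

Lemma dual_zmod C : GRing.zmod_closed (dual C).
Proof.
split=> [|u v /dualP uC /dualP vC]; apply/dualP => w wC; rewrite dotC.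
  exact: dot0.
by rewrite dotB dotC uC // dotC vC // subrr.
Qed.

Lemma submod_zmod C : byte_code C -> GRing.zmod_closed C.
Proof. exact: GRing.submod_closedB. Qed.

Lemma byte_codeZ C a u : byte_code C -> u \in C -> a *: u \in C.
Proof. by move=> [C0 CD] uC; rewrite -[a *: u]addr0 CD. Qed.

Lemma byte_codeD C u v : byte_code C -> u \in C -> v \in C -> u + v \in C.
Proof. by move=> [C0 CD] uC vC; rewrite -[u]scale1r CD. Qed.

(** This is [C + R x], since [R x] is closed under negation. *)
Definition adjoin C x : {set V} := [set u.1 - u.2 *: x | u in setX C setT].

Lemma adjoinP C x y :
  reflect (exists2 r, r \in [set: R] & y + r *: x \in C) (y \in adjoin C x).
Proof.
apply: (iffP imsetP) => [[[c r]]|[r _ yC]].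
  by rewrite inE /= => /andP[cC _] ->; exists r; rewrite ?inE ?subrK.
by exists (y + r *: x, r); rewrite ?inE /= ?yC ?addrK.
Qed.

Lemma adjoin_byte_code C x : byte_code C -> byte_code (adjoin C x).
Proof.
move=> hC; split=> [|a u v /adjoinP[r _ ur] /adjoinP[s _ vs]]; apply/adjoinP.
  by exists 0; rewrite // scale0r addr0; case: hC.
exists (a * r + s) => //; rewrite scalerDl addrACA -scalerA -scalerDr.
by rewrite byte_codeD ?byte_codeZ.
Qed.

Lemma sub_adjoin C x : C \subset adjoin C x.
Proof.
by apply/subsetP => c cC; apply/adjoinP; exists 0; rewrite // scale0r addr0.
Qed.

Lemma mem_adjoin C x : byte_code C -> x \in adjoin C x.
Proof.
move=> [C0 _]; apply/adjoinP; exists (-1) => //.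
by rewrite scaleN1r subrr.
Qed.

Lemma adjoin_sub C D x : byte_code D -> C \subset D -> x \in D ->
  adjoin C x \subset D.
Proof.
move=> hD /subsetP CD xD; apply/subsetP => y /adjoinP[r _ yC].
rewrite -[y](addrK (r *: x)) -scaleNr.
by apply: byte_codeD => //; [apply: CD | apply: byte_codeZ].
Qed.

(** The kernel of [(c, r) |-> c - r x] consists of the pairs [(r x, r)] with [r x] in [C]. *)
Lemma card_adjoin C x : byte_code C ->
  (#|adjoin C x| * #|[set r : R | r *: x \in C]| = #|C| * #|R|)%N.
Proof.
move=> hC; have [C0 CB] := submod_zmod hC.
pose f (u : V * R) : V := u.1 - u.2 *: x.
have := @card_additive_fibers (V * R)%type V (setX C [set: R]) f.
rewrite cardsX cardsT => ->; last 2 first.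
- split=> [|[c r] [d s]]; rewrite !inE /= !andbT //; exact: CB.
- by move=> u v _ _; rewrite /f /= scalerBl !opprB addrACA [RHS]addrACA [- v.1 - _]addrC.
congr (_ * _)%N; rewrite -(@card_imset _ _ (fun r : R => (r *: x, r))); last first.
  by move=> r s [].
apply: eq_card => -[c r]; rewrite !inE /f andbT subr_eq0 /=.
apply/imsetP/andP => [[s]|[cC /eqP cE]].
  by rewrite inE => sC [-> ->].
by exists r; rewrite ?inE -?cE.
Qed.

(** Minimality of [|C + R x|] makes [(C + R x) / C] simple: together with [C], a multiple [r x]
    outside [C] generates all of [C + R x], in particular [x]. The conclusion is the maximality
    condition of [card_annihilator_maximal] for the ideal of all [r] with [r x] in [C]. *)
Lemma adjoin_simple C D x : byte_code C -> x \in D -> x \notin C ->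
    (forall y, y \in D -> y \notin C -> #|adjoin C x| <= #|adjoin C y|)%N ->
    byte_code D ->
  forall r, r *: x \notin C -> exists s, (1 - s * r) *: x \in C.
Proof.
move=> hC xD xC xmin hD r rxC.
have : adjoin C (r *: x) == adjoin C x.
  rewrite eqEcard; apply/andP; split; last first.
    by apply: xmin => //; apply: byte_codeZ.
  apply: adjoin_sub (sub_adjoin _ _) _; first exact: adjoin_byte_code.
  by apply: byte_codeZ (mem_adjoin _ _) => //; apply: adjoin_byte_code.
move/eqP => E; have := mem_adjoin x hC; rewrite -E => /adjoinP[s _ xs].
by exists (- s); rewrite mulNr opprK scalerDl scale1r -scalerA.
Qed.

(* With m the ideal of all r such that r x is in C, the map y |-> x . y sends C^perp into
   Ann(m) and has kernel (C + Rx)^perp. *)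
Lemma card_dual_adjoin C x : byte_code C ->
    (forall r, r *: x \notin C -> exists s, (1 - s * r) *: x \in C) ->
  (#|C| * #|dual C| <= #|adjoin C x| * #|dual (adjoin C x)|)%N.
Proof.
move=> hC xsimple; set m := [set r : R | r *: x \in C].
have m_gt0 : (0 < #|m|)%N.
  by apply/card_gt0P; exists 0; rewrite inE scale0r; case: hC.
(* The factor [|m|] turns [|C + R x|] into [|C| |R|]; after the fiber count for [dot x], what
   remains is that the image of [C^perp] times [|m|] is at most [|R|]. *)
rewrite -(leq_pmul2r m_gt0) [leqRHS]mulnAC card_adjoin //.
rewrite (@card_additive_fibers _ _ (dual C) (dot x)); last 2 first.
- exact: dual_zmod.
- by move=> u v _ _; rewrite !(dotC x) dotB.
have -> : [set u in dual C | dot x u == 0%R] = dual (adjoin C x).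
  apply/setP => u; rewrite inE; apply/andP/dualP => [[/dualP uC /eqP xu] y|uE].
    move/adjoinP => [r _ yC]; rewrite -[y](addrK (r *: x)) dotB uC //.
    by rewrite -[r *: x]addr0 dotP xu mulr0 dot0 addr0 subr0.
  split; last by rewrite uE // mem_adjoin.
  by apply/dualP => y yC; apply: uE; apply: (subsetP (sub_adjoin C x)).
rewrite -!mulnA leq_mul2l; apply/orP; right.
rewrite [(_ * #|m|)%N]mulnC mulnA leq_mul2r; apply/orP; right.
apply: leq_trans (card_annihilator_maximal (m := m) _); last first.
  by move=> r; rewrite inE => /xsimple[s sx]; exists s; rewrite inE.
rewrite leq_mul2r; apply/orP; right.
apply/subset_leq_card/subsetP => c /imsetP[u /dualP uC ->].
rewrite inE; apply/forallP => r; apply/implyP; rewrite inE => rx.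
by have := uC _ rx; rewrite -[r *: x]addr0 dotP dot0 addr0 => ->.
Qed.

(** Climbs from [C] to [D] by induction on [|D| - |C|], adjoining each time an [x] of [D] outside
    [C] with [|C + R x|] minimal, so that the quotient is simple. *)
Lemma card_dual_mono C D : byte_code C -> byte_code D -> C \subset D ->
  (#|C| * #|dual C| <= #|D| * #|dual D|)%N.
Proof.
move=> hC hD; move: {2}(#|D| - #|C|)%N (leqnn (#|D| - #|C|)) => k.
elim: k C hC => [|k IH] C hC le_k CD.
  suff -> : C = D by [].
  by apply/eqP; rewrite eqEcard CD -subn_eq0 -leqn0.
have [DC|] := boolP (D \subset C).
  by have /eqP-> : C == D by rewrite eqEsubset CD.
case/subsetPn => x0 x0D x0C.
have x0DC : (x0 \in D) && (x0 \notin C) by rewrite x0D.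
have [x /andP[xD xC] xmin] := @arg_minnP _ x0 (fun x => (x \in D) && (x \notin C))
  (fun x => #|adjoin C x|) x0DC.
have CE : C \proper adjoin C x.
  rewrite properE sub_adjoin; apply/subsetPn; exists x => //; exact: mem_adjoin.
apply: leq_trans (card_dual_adjoin hC _) (IH _ _ _ _).
- by apply: adjoin_simple hC xD xC _ hD => y yD yC; apply: xmin; rewrite yD.
- exact: adjoin_byte_code.
- by have := proper_card CE; lia.
- exact: adjoin_sub.
Qed.

(** The product is squeezed between its values at the zero code and at the whole space, which are
    each other's duals. *)
Lemma card_dual C : byte_code C -> (#|C| * #|dual C|)%N = #|{: V}|.
Proof.
move=> hC; have h0 : byte_code [set 0 : V].
  split=> [|a u v]; rewrite !inE // => /eqP-> /eqP->.
  by rewrite scaler0 addr0.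
have hT : byte_code [set: V] by split=> [|a u v]; rewrite !inE.
have d0 : dual [set 0 : V] = setT.
  by apply/setP => v; rewrite [RHS]inE; apply/dualP => u /set1P->; rewrite dot0.
have dT : dual [set: V] = [set 0 : V].
  apply/setP => v; rewrite in_set1; apply/dualP/eqP => [h|-> u _].
    by apply/matrixP => i j; rewrite -dot_delta dotC h ?inE // mxE.
  by rewrite dotC dot0.
apply/eqP; rewrite eqn_leq.
have := card_dual_mono hC hT (subsetT _).
rewrite dT cards1 muln1 cardsT => -> /=.
have := card_dual_mono h0 hC; rewrite d0 cards1 mul1n cardsT; apply.
by rewrite sub1set; case: hC.
Qed.

End Dual.
End Annihilator.

(** * The MacWilliams identity for supports *)

Section Krawtchouk.
Variable X : finType.
Implicit Types S T W : {set X}.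

(* The sum of chi(u . v) over all v with support T, for a generating character chi and
   any u with support S. *)
Definition krawtchouk (ell : nat) S T : rat :=
  \prod_(x in T) (if x \in S then -1 else ell%:R - 1).

(** The sum expands a product over [W] of factors increased by 1, which are 0 on [S] and [ell]
    elsewhere. *)
Lemma sum_krawtchouk ell S W :
  \sum_(T : {set X} | T \subset W) krawtchouk ell S T =
    (ell ^ #|W| * [disjoint S & W])%:R.
Proof.
transitivity (\prod_(x in W) ((if x \in S then -1 else ell%:R - 1) + 1 : rat)).
  (* Factors outside [W] are written [0 + 1], so that the product runs over all of [X] and expands
     over all subsets; those not inside [W] contribute 0. *)
  rewrite [RHS]big_mkcond; transitivity (\prod_x ((if x \in W then
      if x \in S then -1 else ell%:R - 1 else 0) + 1 : rat)); last first.
    by apply: eq_bigr => x _; case: ifP; rewrite ?add0r.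
  rewrite bigA_distr [LHS]big_mkcond; apply: eq_bigr => T _.
  case: ifP => [/subsetP TW|/negbT/subsetPn[x xT xW]].
    by rewrite /krawtchouk big_mkcond; apply: eq_bigr => x _; case: ifP => // /TW ->.
  by rewrite (bigD1 x) //= xT (negbTE xW) mul0r.
have [dSW|] := boolP [disjoint S & W].
  rewrite muln1 natrX -prodr_const; apply: eq_bigr => x xW.
  by rewrite (disjointFl dSW xW) subrK.
rewrite -setI_eq0 => /set0Pn[x /setIP[xS xW]].
by rewrite muln0 (bigD1 x) //= xS addNr mul0r.
Qed.

(** Moebius inversion on the subset lattice in the form of injectivity: by induction on [|T|] the
    proper subsets of [T] contribute equally and cancel. *)
Lemma sum_subset_inj (V : zmodType) (f g : {set X} -> V) :
    (forall W, \sum_(T : {set X} | T \subset W) f T =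
               \sum_(T : {set X} | T \subset W) g T) ->
  f =1 g.
Proof.
move=> fg T; move: {2}#|T| (leqnn #|T|) => k.
elim: k T => [|k IH] T kT.
  have -> : T = set0 by apply/eqP; rewrite -cards_eq0 -leqn0.
  by have := fg set0; rewrite !(big_pred1 set0) // => U; rewrite subset0.
have := fg T; rewrite (bigD1 T) //= [in RHS](bigD1 T) //=.
rewrite [in RHS](eq_bigr f) => [/addIr //|U /andP[UT neq]].
apply/esym/IH; rewrite -ltnS; apply: leq_trans kT; apply: proper_card.
by rewrite properEneq neq.
Qed.

End Krawtchouk.

Section MacWilliams.
Variables (R : finComPzRingType) (n b : nat).
Notation V := 'M[R]_(n, b).
Implicit Types (C : {set V}) (W T : {set 'I_n * 'I_b}).

Definition supp (u : V) : {set 'I_n * 'I_b} := [set x | u x.1 x.2 != 0].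

Lemma supp_subP W (u : V) :
  reflect (forall x, x \notin W -> u x.1 x.2 = 0) (supp u \subset W).
Proof.
apply: (iffP subsetP) => h x.
  by move=> xW; apply: contraNeq xW => ux; apply: h; rewrite inE.
by rewrite inE; apply: contraR => /h ->.
Qed.

Lemma card_supp_sub W : #|[set u : V | supp u \subset W]| = (#|R| ^ #|W|)%N.
Proof.
rewrite -(card_pffun_on 0 (mem W) (@predT R)).
pose f (g : {ffun 'I_n * 'I_b -> R}) : V := \matrix_(i, j) g (i, j).
rewrite -(@card_imset _ _ f); last first.
  by move=> g h /matrixP E; apply/ffunP => -[i j]; have := E i j; rewrite !mxE.
apply: eq_card => u; rewrite inE; apply/supp_subP/imsetP => [uW|[g]].
  exists [ffun x => u x.1 x.2]; last by apply/matrixP => i j; rewrite mxE ffunE.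
  apply/pffun_onP; split=> //; apply/subsetP => x; rewrite inE ffunE.
  by apply: contraR => /uW ->.
move=> /pffun_onP[/subsetP gW _] -> [i j] ijW; rewrite mxE /=.
by apply: contraNeq ijW => gij; apply: gW.
Qed.

Hypothesis hR : frobenius R.

(** Let [Z] be the words vanishing on [W]. Then [Z^perp] consists of the [|R|^|W|] words supported
    in [W], and the dual words counted on the left form the dual of [C + Z]. The claim combines
    [card_dual] for [Z] and for [C + Z] with [|C| |Z| = |C + Z| |C & Z|], where [C & Z] is the
    intersection. *)
Lemma card_shortened_dual C W : byte_code C ->
  (#|C| * #|[set u : V in dual C | supp u \subset W]| =
     #|R| ^ #|W| * #|[set u : V in C | [disjoint supp u & W]]|)%N.
Proof.
move=> hC; have [C0 CB] := submod_zmod hC.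
pose Z := [set u : V | [disjoint supp u & W]].
have ZP (u : V) : reflect (forall x, x \in W -> u x.1 x.2 = 0) (u \in Z).
  rewrite inE disjoints_subset; apply: (iffP (supp_subP _ _)) => h x.
    by move=> xW; apply: h; rewrite inE xW.
  by rewrite inE negbK; apply: h.
have hZ : byte_code Z.
  split=> [|a u v /ZP uZ /ZP vZ]; apply/ZP => x xW; first by rewrite mxE.
  by rewrite !mxE uZ // vZ // mulr0 addr0.
have [Z0 ZB] := submod_zmod hZ.
pose f (u : V * V) := u.1 - u.2; pose E := f @: setX C Z.
have EP y : reflect (exists c z, [/\ c \in C, z \in Z & y = c - z]) (y \in E).
  apply: (iffP imsetP) => [[[c z]]|[c [z [cC zZ ->]]]].
    by rewrite inE => /andP[cC zZ] ->; exists c, z.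
  by exists (c, z); rewrite // inE cC.
have hE : byte_code E.
  split; first by apply/EP; exists 0, 0; rewrite subr0.
  move=> a u v /EP[c [z [cC zZ ->]]] /EP[c' [z' [cC' zZ' ->]]]; apply/EP.
  exists (a *: c + c'), (a *: z + z').
  split; [by case: hC => _; apply|by case: hZ => _; apply|].
  by rewrite scalerBr opprD addrACA.
have dualZ : dual Z = [set u : V | supp u \subset W].
  apply/setP => u; rewrite [RHS]inE; apply/dualP/supp_subP => [h [i j] ij|uW z /ZP zZ].
    (* The unit matrix at a position outside [W] lies in [Z] and reads off that entry of [u]. *)
    rewrite /= -dot_delta dotC; apply: h; apply/ZP => -[k l] klW; rewrite mxE /=.
    by case: andP => // -[/eqP ki /eqP lj]; rewrite -ki -lj klW in ij.
  rewrite /dot big1 // => i _; rewrite big1 // => j _.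
  have [ijW|ijW] := boolP ((i, j) \in W); first by rewrite (zZ _ ijW) mul0r.
  by rewrite (uW _ ijW) mulr0.
have -> : [set u : V in dual C | supp u \subset W] = dual E.
  have -> : [set u : V in dual C | supp u \subset W] = dual C :&: dual Z.
    by rewrite dualZ; apply/setP => u; rewrite !inE.
  apply/setP => u; rewrite inE; apply/andP/dualP => [[/dualP uC /dualP uZ] y|h].
    by move=> /EP[c [z [cC zZ ->]]]; rewrite dotB uC // uZ // subrr.
  split; apply/dualP => y yC; last rewrite -[y]opprK; apply: h; apply/EP.
    by exists y, 0; rewrite subr0.
  by exists 0, (- y); rewrite sub0r; split=> //; rewrite -sub0r ZB.
have -> : [set u : V in C | [disjoint supp u & W]] = C :&: Z.
  by apply/setP => u; rewrite !inE.
have := @card_additive_fibers (V * V)%type V (setX C Z) f.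
have -> : #|[set u in setX C Z | f u == 0]| = #|C :&: Z|.
  rewrite -[RHS](@card_imset _ _ (fun u : V => (u, u))); last by move=> u v [].
  apply: eq_card => -[c z]; rewrite !inE /f subr_eq0 /=.
  apply/andP/imsetP => [[/andP[cC zZ] /eqP E1]|[u]].
    by exists c; rewrite ?E1 // !inE -{1}E1 cC.
  by rewrite !inE => /andP[uC uZ] [-> ->]; rewrite uC uZ.
rewrite cardsX => fib.
have {fib} : (#|C| * #|Z| = #|E| * #|C :&: Z|)%N.
  apply: fib.
    split=> [|[c z] [c' z']]; rewrite !inE ?C0 ?Z0 //=.
      by have := Z0; rewrite inE.
    move=> /andP[cC zZ] /andP[cC' zZ']; rewrite CB //=.
    by have := ZB z z'; rewrite !inE; apply.
  by move=> u v _ _; rewrite /f /= !opprD addrACA.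
have := card_dual hR hE; have := card_dual hR hZ.
rewrite dualZ card_supp_sub.
have Z_gt0 : (0 < #|Z|)%N by apply/card_gt0P; exists 0.
move=> <- EE CZ; apply/eqP; rewrite -(eqn_pmul2l Z_gt0) [X in _ == X]mulnA -EE.
by rewrite mulnA [(#|Z| * #|C|)%N]mulnC CZ mulnAC.
Qed.

(** Summed over all [T] inside [W], the left side counts the dual words supported in [W] and the
    right side the words of [C] whose support avoids [W]; these agree by [card_shortened_dual]. *)
Lemma macwilliams_supp C T : byte_code C ->
  #|C|%:R * #|[set u : V in dual C | supp u == T]|%:R =
    \sum_(u in C) krawtchouk #|R| (supp u) T.
Proof.
move=> hC; move: T; apply: sum_subset_inj => W; rewrite exchange_big /=.
under [RHS]eq_bigr => u _ do rewrite sum_krawtchouk natrM.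
rewrite -mulr_sumr -mulr_sumr -!natr_sum -!natrM; congr (_%:R).
rewrite -big_mkcondr sum1_card [RHS]mulnC.
transitivity (#|C| * #|[set u : V in dual C | supp u \subset W]|)%N; last first.
  by rewrite card_shortened_dual // mulnC; congr (_ * _)%N; apply: eq_card => u; rewrite !inE.
congr (_ * _)%N; rewrite -sum1dep_card (partition_big supp (fun T => T \subset W)) /=.
  apply: eq_bigr => T TW; rewrite sum1dep_card; apply: eq_card => u; rewrite !inE.
  by case: eqP => [->|]; rewrite ?TW ?andbT ?andbF.
by move=> u /andP[].
Qed.

(** Dual words are sorted by support. As [F] is arbitrary, it may be a monomial or, when both codes
    are dualized, the outcome of a first transform. *)
Lemma macwilliams (M : lmodType rat) C (F : {set 'I_n * 'I_b} -> M) : byte_code C ->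
  \sum_(u in dual C) F (supp u) = #|C|%:R^-1 *:
    \sum_(u in C) \sum_T krawtchouk #|R| (supp u) T *: F T.
Proof.
move=> hC; rewrite exchange_big scaler_sumr (partition_big supp predT) //=.
apply: eq_bigr => T _; rewrite -scaler_suml -macwilliams_supp // scalerA.
rewrite mulKf; last by rewrite Num.Theory.pnatr_eq0 -lt0n; apply/card_gt0P; exists 0; case: hC.
rewrite scaler_nat -sumr_const; under eq_bigr => u /andP[_ /eqP->] do [].
by apply: eq_bigl => u; rewrite !inE.
Qed.

End MacWilliams.

(** * Binomial and multinomial counts *)

Section Counting.
Local Open Scope nat_scope.

Definition ffun_cons (A : finType) n (a : A) (f : {ffun 'I_n -> A}) :
  {ffun 'I_n.+1 -> A} := [ffun i => oapp f a (unlift ord0 i)].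

Lemma ffun_cons0 (A : finType) n (a : A) (f : {ffun 'I_n -> A}) :
  ffun_cons a f ord0 = a.
Proof. by rewrite ffunE unlift_none. Qed.

Lemma ffun_consS (A : finType) n (a : A) (f : {ffun 'I_n -> A}) i :
  ffun_cons a f (lift ord0 i) = f i.
Proof. by rewrite ffunE liftK. Qed.

Lemma sum_ffun_recl (A : finType) n (F : {ffun 'I_n.+1 -> A} -> nat) :
  \sum_f F f = \sum_a \sum_f F (ffun_cons a f).
Proof.
rewrite pair_big (reindex (fun u : A * {ffun 'I_n -> A} => ffun_cons u.1 u.2)) //=.
exists (fun f => (f ord0, [ffun i => f (lift ord0 i)])) => [[a f]|f] _.
  congr (_, _) => /=; rewrite ?ffun_cons0 //.
  by apply/ffunP => i; rewrite ffunE ffun_consS.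
apply/ffunP => i; have [j|] := unliftP ord0 i => ->; last by rewrite ffun_cons0.
by rewrite ffun_consS ffunE.
Qed.

Lemma forall_ord_recl n (P : pred 'I_n.+1) :
  [forall i, P i] = P ord0 && [forall i, P (lift ord0 i)].
Proof.
apply/forallP/andP => [h|[P0 /forallP PS] i]; first by split=> //; apply/forallP.
by have [j|] := unliftP ord0 i => ->.
Qed.

(** Positions are colored by [c], and choosing [al k] positions of each color [k] is an independent
    choice per color. The induction splits off the first position. *)
Lemma sum_ffun_binomial (K : finType) n (c : 'I_n -> K) (al : K -> nat) :
  \sum_(f : {ffun 'I_n -> bool}) [forall k, \sum_i (f i && (c i == k)) == al k]
    = \prod_k 'C(\sum_i (c i == k), al k).
Proof.
elim: n c al => [|n IH] c al.
  rewrite (big_pred1 [ffun=> true]) => [|f]; last first.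
    by symmetry; apply/eqP/ffunP => -[].
  transitivity ([forall k, 0 == al k] : nat).
    by congr (nat_of_bool _); apply: eq_forallb => k; rewrite big_ord0.
  under eq_bigr do rewrite big_ord0 bin0n.
  have [/forallP h|/forallPn[k hk]] := boolP [forall k, 0 == al k].
    by rewrite big1 // => k _; rewrite eq_sym h.
  by rewrite (bigD1 k) //= eq_sym (negbTE hk).
rewrite sum_ffun_recl big_bool /=.
pose c' i := c (lift ord0 i); pose c0 := c ord0.
have cnt k : \sum_i (c i == k) = (c0 == k) + \sum_i (c' i == k).
  by rewrite big_ord_recl.
have E a (f : {ffun 'I_n -> bool}) k :
    \sum_i (ffun_cons a f i && (c i == k)) =
    (a && (c0 == k)) + \sum_i (f i && (c' i == k)).
  rewrite big_ord_recl ffun_cons0; congr (_ + _).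
  by apply: eq_bigr => i _; rewrite ffun_consS.
have EE a : \sum_(f : {ffun 'I_n -> bool})
      [forall k, \sum_i (ffun_cons a f i && (c i == k)) == al k] =
    \sum_(f : {ffun 'I_n -> bool})
      [forall k, (a && (c0 == k)) + \sum_i (f i && (c' i == k)) == al k].
  apply: eq_bigr => f _; congr (nat_of_bool _); apply: eq_forallb => k.
  by rewrite E.
rewrite !EE /= [X in _ + X = _]IH.
under [RHS]eq_bigr do rewrite cnt.
rewrite [RHS](bigD1 c0) //= [X in _ + X = _](bigD1 c0) //= eqxx.
rewrite [in RHS](eq_bigr (fun k => 'C(\sum_i (c' i == k), al k))) => [|k]; last first.
  by rewrite eq_sym => /negbTE ->.
case E0 : (al c0) => [|m].
  rewrite !bin0 big1 // => f _; case: forallP => // /(_ c0).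
  by rewrite eqxx E0.
(* Pascal's rule for the color of the first position: skipping that position leaves the demand
   [m.+1], taking it leaves [m]. *)
rewrite add1n binS mulnDl addnC; congr (_ + _).
transitivity (\prod_k 'C(\sum_i (c' i == k), if k == c0 then m else al k)).
  rewrite -IH; apply: eq_bigr => f _; congr (nat_of_bool _).
  apply: eq_forallb => k; rewrite [k == c0]eq_sym.
  by have [<-|_] := eqVneq c0 k; rewrite ?E0 ?add1n ?eqSS.
rewrite (bigD1 c0) //= eqxx; congr (_ * _).
by apply: eq_bigr => k /negbTE ->.
Qed.

(** Inside each color class, the arrangements of the prescribed letters number a multinomial
    coefficient. Denominators are cleared to stay in [nat], and the bracket is the condition for any
    arrangement to exist. *)
Lemma sum_ffun_multinomial (A K : finType) (p : A -> K) n (c : 'I_n -> K)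
    (al : A -> nat) :
  (\sum_(f : {ffun 'I_n -> A})
     ([forall i, p (f i) == c i] && [forall a, \sum_i (f i == a) == al a]))
    * \prod_a (al a)`!
  = [forall k, \sum_(a | p a == k) al a == \sum_i (c i == k)]
    * \prod_k (\sum_i (c i == k))`!.
Proof.
elim: n c al => [|n IH] c al.
  rewrite [X in _ = _ * X]big1 => [|k _]; last by rewrite big_ord0.
  rewrite muln1.
  have [/forallP al0|/forallPn[a ala]] := boolP [forall a, 0 == al a]; last first.
    rewrite big1 ?mul0n => [|f _]; last first.
      case: andP => // -[_ /forallP/(_ a)].
      by rewrite big_ord0 (negbTE ala).
    case: forallP => // /(_ (p a)); rewrite big_ord0 sum_nat_eq0.
    by move=> /forallP/(_ a); rewrite eqxx eq_sym (negbTE ala).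
  rewrite [X in _ * X]big1 => [|a _]; last by rewrite -(eqP (al0 a)).
  case: forallP => [_|[] k]; last first.
    by rewrite big_ord0 big1 // => a _; rewrite -(eqP (al0 a)).
  have f0 : 'I_0 -> A by case.
  rewrite (big_pred1 (finfun f0)) => [|f]; last first.
    by symmetry; apply/eqP/ffunP => -[].
  case: andP => // -[]; split; apply/forallP; first by case.
  by move=> a; rewrite big_ord0.
pose c' i := c (lift ord0 i); pose c0 := c ord0.
have cnt k : \sum_i (c i == k) = (c0 == k) + \sum_i (c' i == k).
  by rewrite big_ord_recl.
set mtch := [forall k, _].
(* With first letter [a] the rest is counted by induction with [al a] lowered by one; the factor
   [al a] is what its factorial loses. If [al a = 0], both sides vanish. *)
have step a : (\sum_(f : {ffun 'I_n -> A})
     ([forall i, p (ffun_cons a f i) == c i]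
        && [forall a', \sum_i (ffun_cons a f i == a') == al a']))
    * \prod_a (al a)`! =
    (p a == c0) * al a * (mtch * \prod_k (\sum_i (c' i == k))`!).
  have E (f : {ffun 'I_n -> A}) : ([forall i, p (ffun_cons a f i) == c i]
        && [forall a', \sum_i (ffun_cons a f i == a') == al a']) =
      [&& p a == c0, [forall i, p (f i) == c' i] &
         [forall a', (a == a') + \sum_i (f i == a') == al a']].
    rewrite forall_ord_recl ffun_cons0 -andbA; congr [&& _, _ & _].
      by apply: eq_forallb => i; rewrite ffun_consS.
    apply: eq_forallb => a'; rewrite big_ord_recl ffun_cons0; congr (_ + _ == _).
    by apply: eq_bigr => i _; rewrite ffun_consS.
  rewrite (eq_bigr _ (fun f _ => congr1 nat_of_bool (E f))).
  have [pa|pa] := eqVneq (p a) c0; last by rewrite big1.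
  case ala : (al a) => [|m].
    rewrite big1 // => f _; case: and3P => // -[_ _ /forallP/(_ a)].
    by rewrite eqxx ala.
  pose al' a' := if a' == a then m else al a'.
  rewrite (eq_bigr (fun f : {ffun 'I_n -> A} => ([forall i, p (f i) == c' i]
      && [forall a', \sum_i (f i == a') == al' a'] : nat))) => [|f _]; last first.
    rewrite /=; congr (nat_of_bool (_ && _)); apply: eq_forallb => a'.
    rewrite /al' [a' == a]eq_sym.
    by have [<-|_] := eqVneq a a'; rewrite ?ala ?add1n ?eqSS.
  have -> : \prod_a (al a)`! = m.+1 * \prod_a (al' a)`!.
    rewrite (bigD1 a) //= [in RHS](bigD1 a) //= /al' ala eqxx factS -mulnA.
    by congr (_ * (_ * _)); apply: eq_bigr => a' /negbTE ->.
  rewrite mulnCA IH mul1n; congr (_ * (nat_of_bool _ * _)).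
  apply: eq_forallb => k; rewrite cnt.
  have [<-|ck] := eqVneq c0 k.
    rewrite (bigD1 a) ?pa //= [in RHS](bigD1 a) ?pa //= ala /al' eqxx add1n addSn eqSS.
    congr (_ + _ == _); apply: eq_bigr => a' /andP[_ /negbTE ->] //.
  congr (_ == _); apply: eq_bigr => a' /eqP pa'; rewrite /al'.
  by case: eqP => // aa'; rewrite -pa' aa' pa eqxx in ck.
rewrite sum_ffun_recl big_distrl /=; under eq_bigr do rewrite step.
rewrite -big_distrl /=.
case mE : mtch; last by rewrite !mul0n muln0.
rewrite !mul1n.
(* By [mtch], the letters over the first color are as many as the positions of that color; this
   supplies the top factor of the factorial of the class. *)
have -> : \sum_a (p a == c0) * al a = (\sum_i (c' i == c0)).+1.
  move/forallP: mE => /(_ c0)/eqP; rewrite cnt eqxx add1n => <-.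
  by rewrite [RHS]big_mkcond; apply: eq_bigr => a _; case: eqP; rewrite ?mul1n.
rewrite (bigD1 c0) //= [in RHS](bigD1 c0) //= cnt eqxx add1n factS -mulnA.
by congr (_ * (_ * _)); apply: eq_bigr => k; rewrite eq_sym cnt => /negbTE ->.
Qed.

End Counting.

(** * The transform of one byte *)

Lemma krawtchouk_card (X : finType) ell (S T : {set X}) :
  krawtchouk ell S T = (-1) ^+ #|T :&: S| * (ell%:R - 1) ^+ #|T :\: S|.
Proof.
rewrite /krawtchouk (bigID (mem S)) /= -!prodr_const; congr (_ * _).
  by apply: eq_big => [x|x /andP[_ ->]]; rewrite ?inE.
by apply: eq_big => [x|x /andP[_ /negbTE->]]; rewrite ?inE // andbC.
Qed.

Section Byte.
Variables (t b ell : nat).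
Implicit Types S T U V : {set 'I_b}.

(** For bytes with supports [U] and [V], the three cardinals are [f01], [f10] and [f11]. *)
Definition byte_monomial U V : poly3 :=
  varx ^+ (#|V :\: U| %/ t + eps t #|V :\: U| #|U :&: V|)
  * vary ^+ (#|U :\: V| %/ t + eps t #|U :\: V| #|U :&: V|)
  * varz ^+ (#|U :&: V| %/ t).

Definition class_card S V (T : {ffun 'I_b -> bool}) (k : bool * bool) : nat :=
  \sum_(i < b) (T i && ((i \in S, i \in V) == k)).

(* Numbers the classes [(i \in S, i \in V)] of positions in the order of
   alpha_1, ..., alpha_4 in G. *)
Definition four_class (i : 'I_4) : bool * bool :=
  (~~ odd i, (i < 2)%N).

Definition class_four (k : bool * bool) : 'I_4 :=
  inord (if k.2 then ~~ k.1 : nat else (~~ k.1).+2).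

Lemma class_fourK : cancel class_four four_class.
Proof. by case=> [[] []]; rewrite /four_class inordK. Qed.

Lemma four_classK : cancel four_class class_four.
Proof.
by move=> i; apply: val_inj; case: i => [[|[|[|[|]]]] //= ?]; rewrite inordK.
Qed.

Lemma card_sum_mem (X : finType) (U : {set X}) : #|U| = (\sum_x (x \in U))%N.
Proof. by rewrite -sum1_card big_mkcond. Qed.

Lemma class_card_le S V (T : {ffun _}) k : (class_card S V T k <= b)%N.
Proof.
apply: (@leq_trans (\sum_(i < b) 1)%N); last by rewrite sum1_card card_ord.
by apply: leq_sum => i _; apply: leq_b1.
Qed.

Lemma sum_four (F : 'I_4 -> nat) :
  (\sum_(i < 4) F i = F (inord 0) + F (inord 1) + F (inord 2) + F (inord 3))%N.
Proof.
rewrite !big_ord_recl big_ord0 addn0 !addnA.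
by congr (F _ + F _ + F _ + F _)%N; apply: val_inj; rewrite /= inordK.
Qed.

(** The summand depends on [T] only through the sizes [alpha_1], ..., [alpha_4] of its parts in the
    four classes cut out by [S] and [V]. The number of [T] with given sizes is a product of
    binomials. *)
Lemma sum_byte_monomial_G S V :
  \sum_(T : {set 'I_b}) krawtchouk ell S T *: byte_monomial T V
    = Gbyte t b ell #|S| #|V| #|S :&: V|.
Proof.
set nu := #|S|; set mu := #|V|; set delta := #|S :&: V|.
pose full := [ffun _ : 'I_b => true].
have nE k : (\sum_(i < b) ((i \in S, i \in V) == k))%N = class_card S V full k.
  by apply: eq_bigr => i _; rewrite ffunE.
have [ntt nft ntf nff] : [/\ class_card S V full (true, true) = delta,
    class_card S V full (false, true) + delta = mu,
    class_card S V full (true, false) + delta = nu &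
    class_card S V full (false, false) + mu + nu = b + delta]%N.
  rewrite /mu /nu /delta /class_card !card_sum_mem.
  split; last rewrite -[X in _ = (X + _)%N](card_ord b) -sum1_card;
    rewrite -?big_split; apply: eq_bigr => i _; rewrite !ffunE ?inE;
    by case: (i \in S) (i \in V) => [] [].
(* The class outside both [S] and [V] has nonnegative size, which is the guard of [Gbyte]. *)
rewrite /Gbyte ifT; last by lia.
pose al (a : 4.-tuple 'I_b.+1) k : nat := tnth a (class_four k).
pose aT (T : {ffun 'I_b -> bool}) : 4.-tuple 'I_b.+1 :=
  [tuple inord (class_card S V T (four_class i)) | i < 4].
have aTE (T : {ffun _}) a : (aT T == a) = [forall k, class_card S V T k == al a k].
  apply/eqP/forallP => [<- k|h].
    by rewrite /al tnth_mktuple class_fourK inordK // ltnS class_card_le.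
  apply: eq_from_tnth => i; rewrite tnth_mktuple; apply: val_inj.
  by rewrite /= inordK ?ltnS ?class_card_le // (eqP (h _)) /al four_classK.
pose body (a : 4.-tuple 'I_b.+1) : poly3 :=
  let a1 : nat := tnth a (inord 0) in
  let a2 : nat := tnth a (inord 1) in
  let a3 : nat := tnth a (inord 2) in
  let a4 : nat := tnth a (inord 3) in
  let p := (a1 + a2 + a3 + a4)%N in
  ((-1) ^+ (a1 + a3) * (ell%:R - 1) ^+ (p - a1 - a3)) *:
  (varx ^+ ((mu - a1 - a2) %/ t + eps t (mu - a1 - a2) (a1 + a2))
   * vary ^+ ((p - a1 - a2) %/ t + eps t (p - a1 - a2) (a1 + a2))
   * varz ^+ ((a1 + a2) %/ t)).
have al4 (a : 4.-tuple 'I_b.+1) : [/\ al a (true, true) = tnth a (inord 0),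
  al a (false, true) = tnth a (inord 1), al a (true, false) = tnth a (inord 2) &
  al a (false, false) = tnth a (inord 3)] by [].
have bodyE (T : {ffun 'I_b -> bool}) a : aT T == a ->
    krawtchouk ell S [set i | T i] *: byte_monomial [set i | T i] V = body a.
  rewrite aTE => /forallP cT; have [e1 e2 e3 e4] := al4 a.
  have := eqP (cT (true, true)); have := eqP (cT (true, false)).
  have := eqP (cT (false, true)); have := eqP (cT (false, false)).
  rewrite {}e1 {}e2 {}e3 {}e4 /body.
  move: (tnth a (inord 0) : nat) (tnth a (inord 1) : nat) (tnth a (inord 2) : nat)
    (tnth a (inord 3) : nat) => a1 a2 a3 a4 e4 e2 e3 e1.
  rewrite krawtchouk_card /byte_monomial.
  have -> : #|[set i | T i] :&: S| = (a1 + a3)%N.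
    rewrite -e1 -e3 card_sum_mem -big_split; apply: eq_bigr => i _; rewrite !inE.
    by case: (T i) (i \in S) (i \in V) => [] [] [].
  have -> : #|[set i | T i] :\: S| = (a1 + a2 + a3 + a4 - a1 - a3)%N.
    have -> : (a1 + a2 + a3 + a4 - a1 - a3 = a2 + a4)%N by lia.
    rewrite -e2 -e4 card_sum_mem -big_split; apply: eq_bigr => i _; rewrite !inE.
    by case: (T i) (i \in S) (i \in V) => [] [] [].
  have EI : #|[set i | T i] :&: V| = (a1 + a2)%N.
    rewrite -e1 -e2 card_sum_mem -big_split; apply: eq_bigr => i _; rewrite !inE.
    by case: (T i) (i \in S) (i \in V) => [] [] [].
  have -> : #|[set i | T i] :\: V| = (a1 + a2 + a3 + a4 - a1 - a2)%N.
    have -> : (a1 + a2 + a3 + a4 - a1 - a2 = a3 + a4)%N by lia.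
    rewrite -e3 -e4 card_sum_mem -big_split; apply: eq_bigr => i _; rewrite !inE.
    by case: (T i) (i \in S) (i \in V) => [] [] [].
  have -> : #|V :\: [set i | T i]| = (mu - a1 - a2)%N.
    by rewrite -subnDA -EI /mu -(cardsID [set i | T i] V) setIC addKn.
  by rewrite EI.
rewrite (reindex (fun f : {ffun 'I_b -> bool} => [set i | f i])) /=; last first.
  exists (fun T : {set 'I_b} => [ffun i => i \in T]) => [f|T] _.
    by apply/ffunP => i; rewrite ffunE inE.
  by apply/setP => i; rewrite inE ffunE.
rewrite (partition_big aT predT) //=.
(* On the right, a tuple occurs for at most one [p], the sum of its entries. *)
under [RHS]eq_bigr => p _ do rewrite big_mkcond /=.
rewrite exchange_big /=; apply: eq_bigr => a _.
rewrite (eq_bigr _ (fun T : {ffun _} => bodyE T a)) sumr_const.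
have -> : #|[pred T | aT T == a]| = (\prod_k 'C(class_card S V full k, al a k))%N.
  under eq_bigr do rewrite -nE.
  rewrite -sum_ffun_binomial -sum1_card big_mkcond; apply: eq_bigr => T _.
  by rewrite inE aTE.
rewrite -(pair_bigA _ (fun k1 k2 => 'C(class_card S V full (k1, k2), al a (k1, k2)))).
rewrite /= !big_bool /=; have [-> -> -> ->] := al4 a.
under eq_bigr => p _ do rewrite inE sum_four.
rewrite /body /gcoef.
have := ltn_ord (tnth a (inord 0)).
move: (tnth a (inord 0) : nat) (tnth a (inord 1) : nat) (tnth a (inord 2) : nat)
    (tnth a (inord 3) : nat) => a1 a2 a3 a4 _.
have -> : class_card S V full (false, true) = (mu - delta)%N by lia.
have -> : class_card S V full (true, false) = (nu - delta)%N by lia.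
have E4 : class_card S V full (false, false) = (b + delta - nu - mu)%N by lia.
rewrite ntt E4; have [/and4P[h1 h2 h3 h4]|h] :=
    boolP [&& a1 <= delta, a2 <= mu - delta, a3 <= nu - delta
            & a4 <= b + delta - nu - mu]%N.
  have pb : (a1 + a2 + a3 + a4 < b.+1)%N by lia.
  rewrite (bigD1 (Ordinal pb)) //= eqxx /= big1 ?addr0 => [|p pne].
    rewrite -scaler_nat scalerA mulrA; congr (_%:R * _ * _ *: _).
    by rewrite [(b + _ - mu - nu)%N]subnAC; lia.
  case: ifP => // /andP[/eqP pE _].
  by case/eqP: pne; apply: val_inj; rewrite /= -pE.
(* A tuple that violates a bound lies in no [Aset], and on the left one of its binomials is 0. *)
rewrite big1 => [|p _]; last by rewrite andbF.
rewrite !negb_and -!ltnNge in h.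
by case/or4P: h => h; rewrite (bin_small h) ?(mul0n, muln0) mulr0n.
Qed.

End Byte.

Lemma four_tupleP (X : Type) (a : 4.-tuple X) :
  exists x1 x2 x3 x4, a = [tuple x1; x2; x3; x4].
Proof.
case: a => [[|x1 [|x2 [|x3 [|x4 [|]]]]] //= sz].
by exists x1, x2, x3, x4; apply: val_inj.
Qed.

Lemma in_Tset (x1 x2 x3 x4 : bool) (l1 l2 l3 l4 : option bool) :
  ([tuple x1; x2; x3; x4] \in Tset [tuple l1; l2; l3; l4]) =
  (let ok l x := if l is Some c then x == c else true in
   [&& ok l1 x1, ok l2 x2, ok l3 x3 & ok l4 x4]).
Proof.
rewrite inE !forall_ord_recl.
have -> (P : pred 'I_0) : [forall i, P i] by apply/forallP => -[].
by rewrite andbT.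
Qed.

(** * The transform of one byte in both arguments *)

Section Byte.
Variables (t b ell : nat).
Implicit Types S T U V : {set 'I_b}.

Notation index := {ffun 4.-tuple bool -> 'I_b.+1}.

Definition pattern_counts (f : {ffun 'I_b -> 4.-tuple bool}) : index :=
  [ffun a => inord (\sum_i (f i == a))].

Lemma pattern_countsE f a : pattern_counts f a = (\sum_i (f i == a))%N :> nat.
Proof.
rewrite ffunE inordK // ltnS -[leqRHS]card_ord -sum1_card.
by apply: leq_sum => i _; apply: leq_b1.
Qed.

Lemma Tsum_pattern_counts f l :
  Tsum (pattern_counts f) l = (\sum_i (f i \in Tset l))%N.
Proof.
rewrite /Tsum; under eq_bigr => a _ do rewrite pattern_countsE.
rewrite exchange_big; apply: eq_bigr => i _ /=.
have [fl|fl] := boolP (f i \in Tset l).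
  by rewrite (bigD1 (f i)) //= eqxx big1 // => a /andP[_]; rewrite eq_sym => /negbTE->.
by rewrite big1 // => a al; case: eqP => // fa; rewrite fa al in fl.
Qed.

(** The outer bits record membership in the fixed sets [V] and [S]; the inner bits vary with the
    summation sets. *)
Definition pattern_ends (a : 4.-tuple bool) : bool * bool :=
  (tnth a ord0, tnth a ord_max).

(* The order of the entries is that of the 4-tuples indexing alpha in H: nu, p, q and mu
   are the sizes of [V], [u.2], [u.1] and [S]. *)
Definition patterns S V (u : {set 'I_b} * {set 'I_b}) :
    {ffun 'I_b -> 4.-tuple bool} :=
  [ffun i => [tuple i \in V; i \in u.2; i \in u.1; i \in S]].

(** A pair of subsets amounts to a word of patterns with prescribed outer bits, the inner bits
    giving the pair back. *)
Lemma card_patterns S V (al : index) :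
  #|[pred u | pattern_counts (patterns S V u) == al]| =
  (\sum_(f : {ffun 'I_b -> 4.-tuple bool})
     ([forall i, pattern_ends (f i) == (i \in V, i \in S)]
        && [forall a, \sum_i (f i == a) == al a]))%N.
Proof.
have ends f : (forall i, pattern_ends (f i) = (i \in V, i \in S)) ->
    forall i, exists x y, f i = [tuple i \in V; x; y; i \in S].
  move=> fE i; have [x1 [x2 [x3 [x4 E]]]] := four_tupleP (f i).
  by have := fE i; rewrite E => -[<- <-]; exists x2, x3.
transitivity (\sum_(f : {ffun 'I_b -> 4.-tuple bool} |
    [forall i, pattern_ends (f i) == (i \in V, i \in S)])
  (pattern_counts f == al))%N; last first.
  rewrite big_mkcond; apply: eq_bigr => f _; case: ifP => //= _.
  congr (nat_of_bool _); apply/eqP/forallP => [<- a|h].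
    by rewrite pattern_countsE.
  by apply/ffunP => a; apply: val_inj; rewrite /= pattern_countsE (eqP (h a)).
pose inv (f : {ffun 'I_b -> 4.-tuple bool}) : {set 'I_b} * {set 'I_b} :=
  ([set i | tnth (f i) (@Ordinal 4 2 isT)], [set i | tnth (f i) (@Ordinal 4 1 isT)]).
rewrite (reindex_onto (patterns S V) inv) /= => [|f /forallP fE]; last first.
  apply/ffunP => i; rewrite ffunE !inE.
  by have [|x [y E]] := ends f _ i; [move=> j; apply/eqP|rewrite E].
rewrite -sum1_card big_mkcond [RHS]big_mkcond; apply: eq_bigr => u _ /=.
rewrite inE [RHS]ifT; first by case: eqP.
apply/andP; split; first by apply/forallP => i; rewrite ffunE.
by case: u => T T'; apply/eqP; congr (_, _); apply/setP => i; rewrite inE ffunE.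
Qed.

(** Pairs are grouped by their pattern counts, whose multiplicity is a product of multinomials. The
    monomial takes [T'] before [T] because in H the exponent of x measures [T] minus [T']; this
    causes the exchange of x and y in the final formula. *)
Lemma sum_byte_monomial_H S V :
  \sum_(T : {set 'I_b}) \sum_(T' : {set 'I_b})
    (krawtchouk ell S T * krawtchouk ell V T') *: byte_monomial t T' T
  = Hbyte t b ell #|S| #|V| #|S :&: V|.
Proof.
set nu := #|V|; set mu := #|S|; set delta := #|S :&: V|.
pose nk k := (\sum_(i < b) ((i \in V, i \in S) == k))%N.
have [ntt nft ntf nff] : [/\ nk (true, true) = delta,
    nk (true, false) + delta = nu, nk (false, true) + delta = mu &
    nk (false, false) + mu + nu = b + delta]%N.
  rewrite /mu /nu /delta /nk !card_sum_mem.
  split; last rewrite -[X in _ = (X + _)%N](card_ord b) -sum1_card;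
    rewrite -?big_split; apply: eq_bigr => i _; rewrite ?inE;
    by case: (i \in S) (i \in V) => [] [].
pose body (al : index) : poly3 :=
  let p := Tsum al [tuple None; Some true; None; None] in
  let q := Tsum al [tuple None; None; Some true; None] in
  ((-1) ^+ phi al * (ell%:R - 1) ^+ (p + q - phi al)) *:
      (varx ^+ ((q - psi al) %/ t + eps t (q - psi al) (psi al))
       * vary ^+ ((p - psi al) %/ t + eps t (p - psi al) (psi al))
       * varz ^+ (psi al %/ t)).
have bodyE T T' : (krawtchouk ell S T * krawtchouk ell V T') *: byte_monomial t T' T
    = body (pattern_counts (patterns S V (T, T'))).
  have TE l1 l2 l3 l4 : Tsum (pattern_counts (patterns S V (T, T'))) [tuple l1; l2; l3; l4]
      = (\sum_(i < b) let ok l x := if l is Some c then x == c else true in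
          [&& ok l1 (i \in V), ok l2 (i \in T'), ok l3 (i \in T) & ok l4 (i \in S)])%N.
    by rewrite Tsum_pattern_counts; apply: eq_bigr => i _; rewrite ffunE in_Tset.
  rewrite /body /phi /psi !TE /= {TE}.
  have -> : (\sum_(i < b) [&& true, (i \in T') == true, (i \in T) == true & true])%N
      = #|T' :&: T|.
    by rewrite card_sum_mem; apply: eq_bigr => i _; rewrite inE !eqb_id /= ?andbT.
  have -> : (\sum_(i < b) [&& true, (i \in T') == true, true & true])%N = #|T'|.
    by rewrite card_sum_mem; apply: eq_bigr => i _; rewrite !eqb_id /= ?andbT.
  have -> : (\sum_(i < b) [&& true, true, (i \in T) == true & true])%N = #|T|.
    by rewrite card_sum_mem; apply: eq_bigr => i _; rewrite !eqb_id /= ?andbT.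
  have -> : (\sum_(i < b) [&& (i \in V) == true, (i \in T') == true, true & true])%N
      = #|T' :&: V|.
    by rewrite card_sum_mem; apply: eq_bigr => i _; rewrite inE !eqb_id /= ?andbT andbC.
  have -> : (\sum_(i < b) [&& true, true, (i \in T) == true & (i \in S) == true])%N
      = #|T :&: S|.
    by rewrite card_sum_mem; apply: eq_bigr => i _; rewrite inE !eqb_id.
  rewrite !krawtchouk_card /byte_monomial.
  have c1 := cardsID S T; have c2 := cardsID V T'.
  have -> : #|T :\: T'| = (#|T| - #|T' :&: T|)%N.
    by rewrite -(cardsID T' T) setIC addKn.
  have -> : #|T' :\: T| = (#|T'| - #|T' :&: T|)%N.
    by rewrite -(cardsID T T') addKn.
  have -> : (#|T'| + #|T| - (#|T' :&: V| + #|T :&: S|) = #|T :\: S| + #|T' :\: V|)%N.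
    by lia.
  by rewrite mulrACA -!exprD [(#|T :&: S| + _)%N]addnC.
rewrite pair_bigA /=; under eq_bigr => u _ do rewrite bodyE -surjective_pairing.
rewrite (partition_big (fun u => pattern_counts (patterns S V u)) predT) //=.
rewrite /Hbyte pair_bigA /=.
under [RHS]eq_bigr => pq _ do rewrite big_mkcond /=.
rewrite exchange_big /=; apply: eq_bigr => al _.
rewrite (eq_bigr (fun=> body al)) => [|u /eqP-> //].
rewrite sumr_const card_patterns; set N := (\sum_f _)%N.
have := sum_ffun_multinomial pattern_ends (fun i => (i \in V, i \in S))
  (fun a => al a : nat).
rewrite -/N; set mtch := [forall k, _].
pose mk k := (\sum_(a | pattern_ends a == k) al a)%N.
have [mtt mtf mft mff] : [/\
    Tsum al [tuple Some true; None; None; Some true] = mk (true, true),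
    Tsum al [tuple Some true; None; None; None] = mk (true, false) + mk (true, true),
    Tsum al [tuple None; None; None; Some true] = mk (false, true) + mk (true, true) &
    \sum_a al a = mk (true, true) + mk (true, false) + mk (false, true)
      + mk (false, false)]%N.
  have mkE k : mk k = (\sum_a if pattern_ends a == k then al a : nat else 0)%N.
    exact: big_mkcond.
  rewrite /Tsum; split; rewrite [LHS]big_mkcond !mkE -?big_split; apply: eq_bigr => a _;
    have [x1 [x2 [x3 [x4 ->]]]] := four_tupleP a; rewrite ?in_Tset;
    by case: x1 x4 => [] []; rewrite /= ?addn0 ?add0n.
(* The existence condition of the multinomial count is the part of [Bset] that does not mention p
   and q. *)
have mtchE : mtch = [&& mk (true, true) == delta, mk (true, false) + mk (true, true) == nu,
    mk (false, true) + mk (true, true) == mu &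
    mk (true, true) + mk (true, false) + mk (false, true) + mk (false, false) == b]%N.
  apply/forallP/and4P => [h|[/eqP h1 /eqP h2 /eqP h3 /eqP h4]].
    have := eqP (h (true, true)); have := eqP (h (true, false)).
    have := eqP (h (false, true)); have := eqP (h (false, false)).
    rewrite -/(mk _) -/(mk _) -/(mk _) -/(mk _) -/(nk _) -/(nk _) -/(nk _) -/(nk _).
    by move=> h1 h2 h3 h4; split; apply/eqP; lia.
  have mkn (k1 k2 : bool) : mk (k1, k2) = nk (k1, k2) by case: k1 k2 => [] []; lia.
  by case=> k1 k2; apply/eqP; apply: mkn.
move=> NE; under eq_bigr => pq _ do rewrite inE mtt mtf mft mff.
have prod_gt0 : (0 < \prod_a (al a)`!)%N by apply: prodn_gt0 => a; apply: fact_gt0.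
case mE : mtch NE => /= NE; last first.
  have -> : N = 0%N
    by move/eqP: NE; rewrite mul0n muln_eq0 (gtn_eqF prod_gt0) orbF => /eqP.
  rewrite mulr0n big1 // => pq _; case: ifP => // /and5P[h1 h2 h3 h4 _].
  by rewrite mtchE h1 h2 h3 h4 in mE.
rewrite mtchE in mE; have /and4P[/eqP h1 /eqP h2 /eqP h3 /eqP h4] := mE.
pose p := Tsum al [tuple None; Some true; None; None].
pose q := Tsum al [tuple None; None; Some true; None].
have Tb l : (Tsum al l < b.+1)%N.
  rewrite ltnS -[leqRHS]h4 -mff /Tsum big_mkcond; apply: leq_sum => a _.
  by case: ifP.
(* Only the p and q read off [al] survive; they are at most [b] because the entries of [al] sum to
   [b]. *)
rewrite (bigD1 (Ordinal (Tb _ : p < b.+1)%N, Ordinal (Tb _ : q < b.+1)%N)) //=.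
rewrite -/p -/q h4 h2 h3 h1 !eqxx /= big1 ?addr0 => [|[p' q'] /= ne]; last first.
  case: ifP => // /andP[/eqP pE /eqP qE]; case/eqP: ne.
  by congr (_, _); apply: val_inj; rewrite /= /p /q ?pE ?qE.
rewrite /hcoef /body -/p -/q -scaler_nat scalerA mulrA; congr (_ * _ * _ *: _).
apply: (canRL (mulfK _)); first by rewrite Num.Theory.pnatr_eq0 -lt0n.
rewrite -natrM NE mul1n.
rewrite -(pair_bigA _ (fun k1 k2 => (nk (k1, k2))`!)) /= !big_bool /=.
rewrite ntt; congr (_%:R).
have -> : nk (true, false) = (nu - delta)%N by lia.
have -> : nk (false, true) = (mu - delta)%N by lia.
have -> : nk (false, false) = (b + delta - nu - mu)%N by lia.
by rewrite !mulnA.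
Qed.

End Byte.

(** * Assembling bytes into words *)

Section Bytes.
Variables (n b : nat).
Implicit Types S T U V : {set 'I_n * 'I_b}.

Definition byte (i : 'I_n) T : {set 'I_b} := [set j | (i, j) \in T].

Lemma byteI i U V : byte i (U :&: V) = byte i U :&: byte i V.
Proof. by apply/setP => j; rewrite !inE. Qed.

(** A set of positions is an independent choice of its n bytes, so distributivity applies. *)
Lemma sum_prod_bytes (A : comPzSemiRingType) (F : 'I_n -> {set 'I_b} -> A) :
  \sum_(T : {set 'I_n * 'I_b}) \prod_(i < n) F i (byte i T)
    = \prod_(i < n) \sum_(T : {set 'I_b}) F i T.
Proof.
rewrite bigA_distr_bigA (reindex (fun T : {set 'I_n * 'I_b} => [ffun i => byte i T])) /=.
  by apply: eq_bigr => T _; apply: eq_bigr => i _; rewrite ffunE.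
exists (fun f : {ffun 'I_n -> {set 'I_b}} => [set x : 'I_n * 'I_b | x.2 \in f x.1]) => [T|f] _.
  by apply/setP => -[i j]; rewrite inE ffunE inE.
by apply/ffunP => i; apply/setP => j; rewrite ffunE !inE.
Qed.

Lemma krawtchouk_bytes ell S T :
  krawtchouk ell S T = \prod_(i < n) krawtchouk ell (byte i S) (byte i T).
Proof.
rewrite /krawtchouk big_mkcond; under [RHS]eq_bigr do rewrite big_mkcond.
by rewrite pair_bigA; apply: eq_bigr => -[i j] _; rewrite !inE.
Qed.

Definition word_monomial t U V : poly3 :=
  \prod_(i < n) byte_monomial t (byte i U) (byte i V).

Lemma sum_word_monomial_G t ell S V :
  \sum_T krawtchouk ell S T *: word_monomial t T V
    = \prod_(i < n) Gbyte t b ell #|byte i S| #|byte i V| #|byte i (S :&: V)|.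
Proof.
under [RHS]eq_bigr do rewrite byteI -sum_byte_monomial_G.
rewrite -sum_prod_bytes; apply: eq_bigr => T _.
by rewrite krawtchouk_bytes scaler_prod.
Qed.

Lemma sum_word_monomial_H t ell S V :
  \sum_T \sum_T' (krawtchouk ell S T * krawtchouk ell V T') *: word_monomial t T' T
    = \prod_(i < n) Hbyte t b ell #|byte i S| #|byte i V| #|byte i (S :&: V)|.
Proof.
under [RHS]eq_bigr do rewrite byteI -sum_byte_monomial_H.
rewrite -sum_prod_bytes; apply: eq_bigr => T _.
rewrite -(sum_prod_bytes (fun i (T' : {set 'I_b}) => (krawtchouk ell (byte i S) (byte i T) *
  krawtchouk ell (byte i V) T') *: byte_monomial t T' (byte i T))).
by apply: eq_bigr => T' _; rewrite !krawtchouk_bytes scaler_prod big_split.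
Qed.

End Bytes.

HB.instance Definition _ := GRing.LRMorphism.copy swapxy
  (comp_mpoly [tuple vary; varx; varz]).

(** The exponents of x and y are the same function of the two set differences, and the intersection
    is symmetric. *)
Lemma swapxy_byte_monomial t b (U V : {set 'I_b}) :
  swapxy (byte_monomial t U V) = byte_monomial t V U.
Proof.
rewrite /byte_monomial !rmorphM !rmorphXn /=.
rewrite /swapxy !comp_mpolyXU /= [V :&: U]setIC.
by congr (_ * _); rewrite mulrC.
Qed.

Lemma swapxy_word_monomial t n b (U V : {set 'I_n * 'I_b}) :
  swapxy (word_monomial t U V) = word_monomial t V U.
Proof.
by rewrite rmorph_prod; apply: eq_bigr => i _; apply: swapxy_byte_monomial.
Qed.

(** * Joint enumerators in terms of supports *)

Section Codes.
Variables (R : finComPzRingType) (n b t : nat).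
Notation V := 'M[R]_(n, b).
Implicit Types (C D : {set V}) (u v : V).

(** The exponents see words only through their supports, so [macwilliams] can act on either
    argument. *)
Lemma joint_enumE C D :
  joint_enum t C D = \sum_(u in C) \sum_(v in D)
    word_monomial t (supp u) (supp v).
Proof.
apply: eq_bigr => u _; apply: eq_bigr => v _.
rewrite /word_monomial /byte_monomial !big_split !prodrXr /=.
by congr (_ ^+ _ * _ ^+ _ * _ ^+ _); apply: eq_bigr => i _;
  congr (_ %/ _ + eps _ _ _)%N || congr (_ %/ _)%N;
  apply: eq_card => j; rewrite !inE !mxE ?negbK // andbC.
Qed.

Definition weights (T : {set 'I_n * 'I_b}) : wtuple n b :=
  [ffun i => inord #|byte i T|].

Lemma weightsE T i : weights T i = #|byte i T| :> nat.
Proof. by rewrite ffunE inordK // ltnS -[leqRHS]card_ord max_card. Qed.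

Lemma wD_supp u i : wD u i = #|byte i (supp u)|.
Proof. by apply: eq_card => j; rewrite !inE mxE. Qed.

Lemma wD_cap u v i :
  wD (cap_vec u v) i = #|byte i (supp u :&: supp v)|.
Proof. by apply: eq_card => j; rewrite !inE !mxE; case: ifP. Qed.

Lemma weights_eq T (j : wtuple n b) (w : 'I_n -> nat) :
    (forall i, w i = #|byte i T|) ->
  [forall i, w i == j i] = (weights T == j).
Proof.
move=> wE; apply/forallP/eqP => [h|<- i]; last by rewrite weightsE wE.
by apply/ffunP => i; apply: val_inj; rewrite /= weightsE -wE (eqP (h i)).
Qed.

Lemma sum_Acount C D (Phi : wtuple n b -> wtuple n b -> wtuple n b -> poly3) :
  \sum_(u in C) \sum_(v in D)
    Phi (weights (supp u :&: supp v)) (weights (supp u))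
      (weights (supp v))
  = \sum_(j : wtuple n b) \sum_(k : wtuple n b)
      \sum_(d : wtuple n b | [forall i, (d i <= minn (j i) (k i))%N])
        (Acount C D d j k)%:R * Phi d j k.
Proof.
rewrite pair_big /=.
rewrite (partition_big (fun uv : V * V => weights (supp uv.1)) predT) //=.
apply: eq_bigr => j _.
rewrite (partition_big (fun uv : V * V => weights (supp uv.2)) predT) //=.
apply: eq_bigr => k _.
(* An intersection is no larger than either set, so the range of [d] misses no pair. *)
rewrite (partition_big
  (fun uv : V * V => weights (supp uv.1 :&: supp uv.2))
  (fun d => [forall i, (d i <= minn (j i) (k i))%N])) /=; last first.
  move=> [u v] /= /andP[/andP[_ /eqP<-] /eqP<-]; apply/forallP => i.
  rewrite !weightsE byteI leq_min !subset_leq_card ?subsetIl ?subsetIr //.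
apply: eq_bigr => d _.
rewrite (eq_bigr (fun=> Phi d j k)) => [|uv]; last first.
  by case/andP=> /andP[/andP[_ /eqP->] /eqP->] /eqP->.
rewrite sumr_const mulr_natl; congr (_ *+ _); apply: eq_card => -[u v].
rewrite !inE /= (weights_eq (T := supp u)); last exact: wD_supp.
rewrite (weights_eq (T := supp v)); last exact: wD_supp.
rewrite (weights_eq (T := supp u :&: supp v)); last exact: wD_cap.
by rewrite -topredE /= -!andbA.
Qed.

End Codes.

Unset Implicit Arguments.

Theorem theorem4p10 (R : finComPzRingType) (ell b n t : nat)
    (hR : frobenius R) (hell : #|R| = ell)
    (hb : (1 <= b)%N) (hn : (1 <= n)%N) (ht : (1 <= t <= b)%N)
    (C D : {set 'M[R]_(n, b)}) (hC : byte_code C) (hD : byte_code D) :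
  [/\ joint_enum t (dual C) D
        = #|C|%:R^-1 *:
          \sum_(j : wtuple n b) \sum_(k : wtuple n b)
            \sum_(d : wtuple n b | [forall i, (d i <= minn (j i) (k i))%N])
              (Acount C D d j k)%:R * Gpoly t ell d j k,
      joint_enum t C (dual D)
        = #|D|%:R^-1 *:
          \sum_(j : wtuple n b) \sum_(k : wtuple n b)
            \sum_(d : wtuple n b | [forall i, (d i <= minn (j i) (k i))%N])
              (Acount C D d j k)%:R * swapxy (Gpoly t ell d k j)
    & joint_enum t (dual C) (dual D)
        = (#|C|%:R * #|D|%:R)^-1 *:
          \sum_(j : wtuple n b) \sum_(k : wtuple n b)
            \sum_(d : wtuple n b | [forall i, (d i <= minn (j i) (k i))%N])
              (Acount C D d j k)%:R * swapxy (Hpoly t ell d j k)].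
Proof.
rewrite -hell; split.
(* With [v] in [D] outermost, the inner sum over [dual C] is transformed for each fixed [v]. *)
- rewrite -sum_Acount joint_enumE exchange_big [in RHS]exchange_big /= scaler_sumr.
  apply: eq_bigr => v _.
  rewrite (macwilliams hR (fun T => word_monomial t T (supp v))) //.
  congr (_ *: _); apply: eq_bigr => u _; rewrite sum_word_monomial_G.
  by apply: eq_bigr => i _; rewrite !weightsE.
- rewrite -(sum_Acount _ _ (fun d j k => swapxy (Gpoly t #|R| d k j))).
  rewrite joint_enumE scaler_sumr; apply: eq_bigr => u _.
  rewrite (macwilliams hR (fun T => word_monomial t (supp u) T)) //.
  congr (_ *: _); apply: eq_bigr => v _.
  (* The transformed set is now the second argument; exchanging x and y puts it first, where
     [sum_word_monomial_G] applies. *)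
  under eq_bigr do rewrite -swapxy_word_monomial -linearZ.
  rewrite -linear_sum sum_word_monomial_G; congr (swapxy _).
  by apply: eq_bigr => i _; rewrite !weightsE setIC.
- rewrite -(sum_Acount _ _ (fun d j k => swapxy (Hpoly t #|R| d j k))).
  rewrite joint_enumE.
  under eq_bigr => u _ do rewrite
    (macwilliams hR (fun T => word_monomial t (supp u) T)) //.
  (* The inner sum, already transformed to [D], depends on [u] only through its support, so it is
     itself an admissible function for the transform to [C]. *)
  rewrite (macwilliams hR (fun T => #|D|%:R^-1 *: \sum_(v in D)
    \sum_T' krawtchouk #|R| (supp v) T' *: word_monomial t T T')) //.
  rewrite invfM -scalerA; congr (_ *: _); rewrite scaler_sumr; apply: eq_bigr => u _.
  under eq_bigr do rewrite scalerA mulrC -scalerA scaler_sumr.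
  rewrite -scaler_sumr exchange_big /=; congr (_ *: _); apply: eq_bigr => v _.
  under eq_bigr => T _.
    rewrite scaler_sumr.
    under eq_bigr => T' _ do rewrite scalerA -swapxy_word_monomial -linearZ.
    rewrite -linear_sum; over.
  rewrite -linear_sum sum_word_monomial_H; congr (swapxy _).
  by apply: eq_bigr => i _; rewrite !weightsE.
Qed.
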